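(* Let $p\in\mathbb{N}$, let $\alpha,\beta$ be complex-valued sequences on $\mathbb{Z}$, and let $\{f_\ell\}_{\ell=0,\dots,p}$, $\{g_\ell\}_{\ell=0,\dots,p+1}$, $\{h_\ell\}_{\ell=0,\dots,p+1}$ be complex-valued sequences on $\mathbb{Z}$ with the normalization $g_0=1$. Put $$F_p(z,n)=\sum_{\ell=0}^{p} f_{p-\ell}(n) z^\ell,\quad G_{p+1}(z,n)=\sum_{\ell=0}^{p+1} g_{p+1-\ell}(n) z^\ell,\quad H_{p+1}(z,n)=\sum_{\ell=0}^{p+1} h_{p+1-\ell}(n) z^\ell,$$ $$U(z,n)=\begin{pmatrix} z&\alpha(n)\\ z\beta(n)&1\end{pmatrix},\qquad V_{p+1}(z,n)=\begin{pmatrix} G_{p+1}^-(z,n)&-F_p^-(z,n)\\ H_{p+1}^-(z,n)&-G_{p+1}^-(z,n)\end{pmatrix}.$$ Then the stationary zero-curvature condition $$U(z,n)V_{p+1}(z,n)-V_{p+1}^+(z,n)U(z,n)=0\quad\text{for all } z\in\mathbb{C},\ n\in\mathbb{Z},$$ holds if and only if the following conditions (a) and (b) are satisfied. (a) $f_0=-2\alpha^+$, $h_0=2\beta$, $h_{p+1}=0$, and $$g_{\ell+1}-g_{\ell+1}^-=\alpha h_\ell^-+\beta f_\ell,\quad f_{\ell+1}^-=f_\ell-\alpha(g_{\ell+1}+g_{\ell+1}^-),\quad h_{\ell+1}=h_\ell^-+\beta(g_{\ell+1}+g_{\ell+1}^-),\qquad \ell=0,\dots,p-1.$$ (b) $g_{p+1}=g_{p+1}^+$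 (that is, $g_{p+1}$ is independent of $n$), and $\alpha,\beta$ satisfy the coupled system of nonlinear difference equations $$f_p-2g_{p+1}\alpha=0,\qquad h_p^-+2g_{p+1}\beta=0.$$
   Context: For a sequence $f$ on $\mathbb{Z}$ write $f^\pm(n)=f(n\pm1)$; the same convention applies to $2\times2$ matrices and their entries. All identities between sequences hold at every $n\in\mathbb{Z}$. The system in (b), with $f_p,h_p$ determined from $\alpha,\beta$ by the recursion in (a), is called the $p$th stationary SB (Szegő–Baxter) system. *)

(* Defs.v *)
From HB Require Import structures.
From mathcomp Require Import all_boot all_order all_algebra.
From mathcomp Require Import reals complex.

Set Implicit Arguments.
Unset Strict Implicit.
Unset Printing Implicit Defensive.

Import Order.TTheory GRing.Theory Num.Theory.
Local Open Scope ring_scope.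
Local Open Scope complex_scope.

(* f^+ and f^- for sequences on the integers; T is arbitrary so that the same
   shifts apply to scalar sequences and to sequences of matrices. *)
Definition fwd (T : Type) (f : int -> T) : int -> T := fun n => f (n + 1).
Definition bwd (T : Type) (f : int -> T) : int -> T := fun n => f (n - 1).

Definition mx2 (T : Type) (a b c d : T) : 'M[T]_2 :=
  \matrix_(i < 2, j < 2)
    if i == 0 then (if j == 0 then a else b) else (if j == 0 then c else d).

(* z |-> sum_{l = 0}^{d} c_{d-l}(n) z^l.  A finite family (c_l)_{l = 0..d} is
   represented by a function on nat, of which only the values at l <= d are
   ever used. *)
Definition rev_poly (R : realType) (d : nat) (c : nat -> int -> R[i])
    (z : R[i]) : int -> R[i] :=
  fun n => \sum_(l < d.+1) c (d - l)%N n * z ^+ l.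

Definition Umx (R : realType) (alpha beta : int -> R[i]) (z : R[i]) :
    int -> 'M[R[i]]_2 :=
  fun n => mx2 z (alpha n) (z * beta n) 1.

Definition Vmx (R : realType) (p : nat) (f g h : nat -> int -> R[i])
    (z : R[i]) : int -> 'M[R[i]]_2 :=
  let F := rev_poly p f z in
  let G := rev_poly p.+1 g z in
  let H := rev_poly p.+1 h z in
  fun n => mx2 (bwd G n) (- bwd F n) (bwd H n) (- bwd G n).

Definition zero_curvature (R : realType) (p : nat) (alpha beta : int -> R[i])
    (f g h : nat -> int -> R[i]) : Prop :=
  forall (z : R[i]) (n : int),
    Umx alpha beta z n *m Vmx p f g h z n
    - fwd (Vmx p f g h z) n *m Umx alpha beta z n = 0.

Definition SB_recursion (R : realType) (p : nat) (alpha beta : int -> R[i])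
    (f g h : nat -> int -> R[i]) : Prop :=
  [/\ forall n, f 0%N n = - 2 * fwd alpha n,
      forall n, h 0%N n = 2 * beta n,
      forall n, h p.+1 n = 0
    & forall (l : nat), (l < p)%N -> forall n,
      [/\ g l.+1 n - bwd (g l.+1) n = alpha n * bwd (h l) n + beta n * f l n,
          bwd (f l.+1) n = f l n - alpha n * (g l.+1 n + bwd (g l.+1) n)
        & h l.+1 n = bwd (h l) n + beta n * (g l.+1 n + bwd (g l.+1) n)]].

(* The last two equations form the pth stationary SB (Szego-Baxter) system;
   f, g, h are tied to alpha, beta by SB_recursion, with which this is always
   conjoined. *)
Definition stationary_SB (R : realType) (p : nat) (alpha beta : int -> R[i])
    (f g h : nat -> int -> R[i]) : Prop :=
  [/\ forall n, g p.+1 n = fwd (g p.+1) n,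
      forall n, f p n - 2 * g p.+1 n * alpha n = 0
    & forall n, bwd (h p) n + 2 * g p.+1 n * beta n = 0].

(* Main.v *)
Require Import Defs.
From HB Require Import structures.
From mathcomp Require Import all_boot all_order all_algebra.
From mathcomp Require Import reals complex.
From mathcomp Require Import ring.

Set Implicit Arguments.
Unset Strict Implicit.
Unset Printing Implicit Defensive.

Import Order.TTheory GRing.Theory Num.Theory.
Local Open Scope ring_scope.
Local Open Scope complex_scope.

(** The four entries of U V - V^+ U are polynomials in z, so the zero-curvature
    condition says that all their coefficients vanish. Off the extreme degrees
    the entries (1,1), (1,2), (2,1) give the three recursions. The lowest
    coefficient of (2,1) gives h_{p+1} = 0, then that of (2,2) makes g_{p+1}
    constant, and with these the coefficient of z^0 in (1,2) and of z^1 in (2,1)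
    give the SB system. Conversely, the remaining coefficients, those of (2,2)
    and the one of z^1 in (1,1), are consequences of the other equations. *)

(** A nonzero polynomial has fewer roots than its size, but characteristic zero makes 0, 1, 2, ...
    pairwise distinct roots, as many as wanted. *)
Lemma horner_ext_eq0 (K : numDomainType) (P : {poly K}) :
  (forall z, P.[z] = 0) -> P = 0.
Proof.
move=> P0; apply/eqP; case: eqP => // /eqP Pneq0.
have := @max_poly_roots _ P [seq i%:R | i <- iota 0 (size P)] Pneq0.
rewrite size_map size_iota ltnn => -> //.
  by apply/allP => x _; apply/rootP.
by rewrite map_inj_uniq ?iota_uniq // => i j /eqP; rewrite eqr_nat => /eqP.
Qed.

Lemma mx2_eq0 (K : nmodType) (a b c d : K) :
  mx2 a b c d = 0 <-> [/\ a = 0, b = 0, c = 0 & d = 0].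
Proof.
split=> [/matrixP e | [-> -> -> ->]].
  by split; [have := e 0 0 | have := e 0 1 | have := e 1 0 | have := e 1 1];
    rewrite !mxE.
by apply/matrixP => i j; rewrite !mxE; do 2 case: ifP.
Qed.

Lemma mx2_mul (K : pzSemiRingType) (a b c d a' b' c' d' : K) :
  mx2 a b c d *m mx2 a' b' c' d' =
  mx2 (a * a' + b * c') (a * b' + b * d') (c * a' + d * c') (c * b' + d * d').
Proof.
apply/matrixP => i j; rewrite !mxE !big_ord_recl big_ord0 addr0 !mxE /=.
by do 2 case: ifP.
Qed.

Lemma mx2_sub (K : zmodType) (a b c d a' b' c' d' : K) :
  mx2 a b c d - mx2 a' b' c' d' = mx2 (a - a') (b - b') (c - c') (d - d').
Proof. by apply/matrixP => i j; rewrite !mxE; do 2 case: ifP. Qed.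

(** [rev_poly] at one fixed site [n], to which it is convertible; this leaves plain polynomial
    algebra in [z]. *)
Definition rev_sum (K : pzSemiRingType) (d : nat) (c : nat -> K) (z : K) : K :=
  \sum_(l < d.+1) c (d - l)%N * z ^+ l.

(* Sequences are read from the top degree down, so at formal degree [d.+1]
   multiplying by [z] extends the sequence by a zero ([pad]), while leaving the
   sum unchanged prepends one ([shift]). *)
Definition pad (K : nmodType) (d : nat) (c : nat -> K) (k : nat) : K :=
  if (k <= d)%N then c k else 0.

Definition shift (K : nmodType) (c : nat -> K) (k : nat) : K :=
  if k is k'.+1 then c k' else 0.

Section RevSum.
Variables (K : comPzRingType) (d : nat).
Implicit Types (c : nat -> K) (z : K).

Lemma rev_sum_shift c z : rev_sum d c z = rev_sum d.+1 (shift c) z.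
Proof.
rewrite /rev_sum [RHS]big_ord_recr /= subnn mul0r addr0.
by apply: eq_bigr => l _; rewrite subSn // -ltnS.
Qed.

Lemma rev_sum_pad c z : z * rev_sum d c z = rev_sum d.+1 (pad d c) z.
Proof.
rewrite /rev_sum [RHS]big_ord_recl /= {1}/pad ltnn mul0r add0r mulr_sumr.
apply: eq_bigr => l _; rewrite /bump add1n subSS /pad leq_subr exprS; ring.
Qed.

Lemma rev_sumD c c' z :
  rev_sum d c z + rev_sum d c' z = rev_sum d (fun k => c k + c' k) z.
Proof. by rewrite -big_split; apply: eq_bigr => l _; rewrite mulrDl. Qed.

Lemma rev_sumN c z : - rev_sum d c z = rev_sum d (fun k => - c k) z.
Proof. by rewrite -sumrN; apply: eq_bigr => l _; rewrite mulNr. Qed.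

Lemma rev_sumZ a c z : a * rev_sum d c z = rev_sum d (fun k => a * c k) z.
Proof. by rewrite mulr_sumr; apply: eq_bigr => l _; rewrite mulrA. Qed.

End RevSum.

(** The entry [c k] is the coefficient of degree [d - k], and [k] is recovered from [d - k] because
    [k <= d]. *)
Lemma rev_sum_eq0 (K : numDomainType) (d : nat) (c : nat -> K) :
  (forall z, rev_sum d c z = 0) <-> (forall k, (k <= d)%N -> c k = 0).
Proof.
split=> [c0 k kd | c0 z]; last first.
  by apply: big1 => l _; rewrite c0 ?leq_subr // mul0r.
have /polyP/(_ (d - k)%N) : \poly_(l < d.+1) c (d - l)%N = 0.
  by apply: horner_ext_eq0 => z; rewrite horner_poly; apply: c0.
by rewrite coef_poly coef0 ltnS leq_subr subKn.
Qed.

(** The index [k] counts down from the formal degree [d]: each condition is the coefficient of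
    [z ^+ (d - k)], with [d = p.+2] for the entries (1,1), (2,1) and [d = p.+1] for (1,2), (2,2). *)
Lemma zero_curvature_coef (R : realType) (p : nat) (alpha beta : int -> R[i])
    (f g h : nat -> int -> R[i]) :
  zero_curvature p alpha beta f g h <-> forall n,
  [/\ forall k, (k <= p.+2)%N ->
        pad p.+1 (fun l => bwd (g l) n - g l n) k
        + shift (fun l => alpha n * bwd (h l) n
                          + beta n * pad p (fun l => f l n) l) k = 0,
      forall k, (k <= p.+1)%N ->
        shift (fun l => f l n) k - pad p (fun l => bwd (f l) n) k
        - alpha n * (g k n + bwd (g k) n) = 0,
      forall k, (k <= p.+2)%N ->
        shift (fun l => bwd (h l) n) k
        + pad p.+1 (fun l => beta n * (g l n + bwd (g l) n) - h l n) k = 0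
    & forall k, (k <= p.+1)%N ->
        g k n - bwd (g k) n - alpha n * h k n
        - beta n * pad p (fun l => bwd (f l) n) k = 0].
Proof.
pose S d (c : nat -> int -> R[i]) n z := rev_sum d (c^~ n) z.
have SE d c z n : rev_poly d c z n = S d c n z by [].
(* The forward shift of [V] cancels its built-in backward shift. Terms are grouped so that each
   factor [z] stands before a sum and can be absorbed by [pad]. *)
have entries z n :
  Umx alpha beta z n *m Vmx p f g h z n
  - fwd (Vmx p f g h z) n *m Umx alpha beta z n =
  mx2 (z * S p.+1 g (n - 1) z + alpha n * S p.+1 h (n - 1) z
       - z * S p.+1 g n z + beta n * (z * S p f n z))
      (S p f n z - z * S p f (n - 1) z
       - alpha n * (S p.+1 g n z + S p.+1 g (n - 1) z))
      (S p.+1 h (n - 1) z - z * S p.+1 h n z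
       + z * (beta n * (S p.+1 g n z + S p.+1 g (n - 1) z)))
      (S p.+1 g n z - S p.+1 g (n - 1) z - alpha n * S p.+1 h n z
       - beta n * (z * S p f (n - 1) z)).
  rewrite /Umx /Vmx /fwd /bwd addrK !mx2_mul mx2_sub !SE.
  by congr mx2; ring.
have e11 z n : z * S p.+1 g (n - 1) z + alpha n * S p.+1 h (n - 1) z
    - z * S p.+1 g n z + beta n * (z * S p f n z) =
  rev_sum p.+2 (fun k => pad p.+1 (fun l => bwd (g l) n - g l n) k
        + shift (fun l => alpha n * bwd (h l) n
                          + beta n * pad p (fun l => f l n) l) k) z.
  rewrite -rev_sumD -rev_sum_pad -rev_sum_shift -!rev_sumD -rev_sumN.
  by rewrite -!rev_sumZ -rev_sum_pad /S /bwd; ring.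
have e12 z n : S p f n z - z * S p f (n - 1) z
    - alpha n * (S p.+1 g n z + S p.+1 g (n - 1) z) =
  rev_sum p.+1 (fun k =>
    shift (fun l => f l n) k - pad p (fun l => bwd (f l) n) k
    - alpha n * (g k n + bwd (g k) n)) z.
  rewrite -!rev_sumD -!rev_sumN -rev_sumZ -rev_sumD.
  by rewrite -rev_sum_pad -rev_sum_shift.
have e21 z n : S p.+1 h (n - 1) z - z * S p.+1 h n z
    + z * (beta n * (S p.+1 g n z + S p.+1 g (n - 1) z)) =
  rev_sum p.+2 (fun k => shift (fun l => bwd (h l) n) k
    + pad p.+1 (fun l => beta n * (g l n + bwd (g l) n) - h l n) k) z.
  rewrite -rev_sumD -rev_sum_pad -rev_sum_shift -rev_sumD -rev_sumN.
  by rewrite -!rev_sumZ -rev_sumD /S /bwd; ring.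
have e22 z n : S p.+1 g n z - S p.+1 g (n - 1) z - alpha n * S p.+1 h n z
    - beta n * (z * S p f (n - 1) z) =
  rev_sum p.+1 (fun k => g k n - bwd (g k) n - alpha n * h k n
        - beta n * pad p (fun l => bwd (f l) n) k) z.
  by rewrite -!rev_sumD -!rev_sumN -!rev_sumZ -rev_sum_pad.
split=> [zc n | coef z n].
  have zc' z := (mx2_eq0 _ _ _ _).1 (etrans (esym (entries z n)) (zc z n)).
  split; apply/rev_sum_eq0 => z; case: (zc' z) => E11 E12 E21 E22.
  - by rewrite -e11.
  - by rewrite -e12.
  - by rewrite -e21.
  - by rewrite -e22.
rewrite entries; apply/mx2_eq0; rewrite e11 e12 e21 e22.
by case: (coef n) => C11 C12 C21 C22; split; move: z; apply/rev_sum_eq0.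
Qed.

Theorem mainTheorem1 (R : realType) (p : nat) (alpha beta : int -> R[i])
    (f g h : nat -> int -> R[i]) (hg0 : forall n : int, g 0%N n = 1) :
  zero_curvature p alpha beta f g h <->
  SB_recursion p alpha beta f g h /\ stationary_SB p alpha beta f g h.
Proof.
split=> [/zero_curvature_coef zc | [[f0 h0 hp rec] [gconst sysf sysh]]].
  have hp n : h p.+1 n = 0.
    (* The constant term of (2,1) at a site contains [h p.+1] at the preceding site, hence the use
       of [n + 1]. *)
    have [_ _ /(_ p.+2 (leqnn _)) + _] := zc (n + 1).
    by rewrite /= /pad ltnn addr0 /bwd addrK.
  have gconst n : bwd (g p.+1) n = g p.+1 n.
    have [_ _ _ /(_ p.+1 (leqnn _))] := zc n.
    by rewrite /pad ltnn hp !mulr0 !subr0 => /subr0_eq.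
  split; split.
  (* The leading coefficient of (1,2) likewise sees [f 0] one site back; [hg0] turns the sum of the
     two [g] terms into 2. *)
  - move=> n; have [_ /(_ 0%N isT) + _ _] := zc (n + 1).
    rewrite /= /pad /= /bwd !hg0 addrK => e; rewrite /fwd.
    by apply: subr0_eq; rewrite -oppr0 -e; ring.
  - move=> n; have [_ _ /(_ 0%N isT) + _] := zc n.
    rewrite /= /pad /= /bwd !hg0 => e.
    by apply: subr0_eq; rewrite -oppr0 -e; ring.
  - exact: hp.
  - move=> l lp n; have [C11 C12 C21 _] := zc n.
    have lp1 : (l < p.+1)%N by exact: ltnW.
    split.
    + have := C11 l.+1 (ltnW lp1); rewrite /= /pad lp1 -ltnS lp1 => e.
      by apply: subr0_eq; rewrite -oppr0 -e; ring.
    + have := C12 l.+1 lp1; rewrite /= /pad lp => e.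
      by apply: subr0_eq; rewrite -oppr0 -e; ring.
    + have := C21 l.+1 (ltnW lp1); rewrite /= /pad lp1 => e.
      by apply: subr0_eq; rewrite -oppr0 -e; ring.
  - by move=> n; rewrite -[RHS]gconst /fwd /bwd addrK.
  - move=> n; have [_ /(_ p.+1 (leqnn _)) + _ _] := zc n.
    rewrite /= /pad ltnn gconst => e; rewrite -[RHS]e; ring.
  (* The formal degree is [p.+2] here, so [p.+1] picks out the coefficient of [z], where [h p.+1]
     still occurs and is removed by [hp]. *)
  - move=> n; have [_ _ /(_ p.+1 (leqnSn _)) + _] := zc n.
    rewrite /= /pad leqnn gconst hp => e; rewrite -[RHS]e; ring.
have gm n : bwd (g p.+1) n = g p.+1 n by rewrite /bwd gconst /fwd subrK.
have f0m n : bwd (f 0%N) n = - 2 * alpha n by rewrite /bwd f0 /fwd subrK.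
have fp n : f p n = 2 * g p.+1 n * alpha n by apply: subr0_eq.
have hpm n : bwd (h p) n = - (2 * g p.+1 n * beta n).
  by apply/eqP; rewrite -addr_eq0 sysh.
apply/zero_curvature_coef => n; split=> -[|k] /=.
- by move=> _; rewrite /pad /= /bwd !hg0 subrr addr0.
- rewrite ltnS leq_eqVlt => /predU1P[->|kp1].
    by rewrite /pad !ltnn /bwd hp !mulr0 !addr0.
  rewrite /pad kp1 -ltnS kp1; move: kp1; rewrite ltnS leq_eqVlt.
  (* Coefficient of [z] in (1,1): by the SB system, [alpha n * bwd (h p) n] and [beta n * f p n] are
     opposite. *)
  case/predU1P=> [->|kp]; first by rewrite gm hpm fp; ring.
  by have [e _ _] := rec k kp n; rewrite -opprB e; ring.
- by move=> _; rewrite /pad /= f0m /bwd !hg0; ring.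
- rewrite ltnS leq_eqVlt => /predU1P[->|kp].
    by rewrite /pad ltnn gm fp; ring.
  by have [_ e _] := rec k kp n; rewrite /pad kp e; ring.
- by move=> _; rewrite /pad /= h0 /bwd !hg0; ring.
- rewrite ltnS leq_eqVlt => /predU1P[->|kp1].
    by rewrite /pad ltnn /bwd hp addr0.
  rewrite /pad kp1; move: kp1; rewrite ltnS leq_eqVlt.
  case/predU1P=> [->|kp]; first by rewrite gm hpm hp; ring.
  by have [_ _ e] := rec k kp n; rewrite e; ring.
- by move=> _; rewrite /pad /= h0 f0m /bwd !hg0; ring.
- rewrite ltnS leq_eqVlt => /predU1P[->|kp].
    by rewrite /pad ltnn gm hp; ring.
  (* After substitution of the three recursions, the two products of [alpha n * beta n] with
     [g k.+1 n + bwd (g k.+1) n] cancel. *)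
  have [e1 e2 e3] := rec k kp n.
  by rewrite /pad kp e1 e2 e3; ring.
Qed.
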